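(* Let $n\ge 4$, $r>0$, $a>0$, and $\gamma:=a^2(n-1)/(a^2+n-3)$. Consider the $2n-2$ spheres in $\mathbb{R}^n$, all of radius $r$, with centers $$c_1=(1,1,1,0,\dots,0)^{\mathrm T},\quad c_2=(1,-1,-1,0,\dots,0)^{\mathrm T},\quad c_3=(-1,1,-1,0,\dots,0)^{\mathrm T},\quad c_4=(-1,-1,1,0,\dots,0)^{\mathrm T},$$ together with the points $a e_j$ and $-a e_j$ for $j=4,5,\dots,n$, where $e_1,\dots,e_n$ are the standard unit vectors of $\mathbb{R}^n$. If $$(r^2-3)\,(3-\gamma)\,(a^2-2)\,(r^2-\gamma)\,\bigl((3-\gamma)^2+4\gamma-4r^2\bigr)\ne 0,$$ then there are exactly $3\cdot 2^{n-1}$ different (complex) lines tangent to all $2n-2$ spheres. If $$a^2>2,\qquad \gamma<3,\qquad\text{and}\qquad \gamma<r^2<\gamma+\tfrac14(3-\gamma)^2,$$ then all these $3\cdot 2^{n-1}$ lines are real. Furthermore, this last system of inequalities defines a nonempty subset of the $(a,r)$-plane (with $a,r>0$).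
   Context: For $x,y\in\mathbb{C}^n$ write $x\cdot y:=\sum_{i=1}^n x_iy_i$ (bilinear, no complex conjugation) and $x^2:=x\cdot x$. A (complex) line in $\mathbb{C}^n$ is given by a point $p\in\mathbb{C}^n$ on it and a direction $v\in\mathbb{C}^n\setminus\{0\}$. The line is tangent to the sphere with center $c\in\mathbb{R}^n$ and radius $r>0$ if it is tangent to the complex quadric hypersurface $(x-c)^2=r^2$, i.e. the quadratic equation $(p+tv-c)^2=r^2$ in $t$ has a solution of multiplicity two, expressed by the vanishing of its discriminant: $[v\cdot(p-c)]^2=v^2\,((p-c)^2-r^2)$. A line is real if $p$ and $v$ can be chosen in $\mathbb{R}^n$; for a real line, tangency to the sphere is equivalent to having Euclidean distance $r$ from $c$. *)

(* Defs.v *)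
From HB Require Import structures.
From mathcomp Require Import all_boot all_order all_algebra.
From mathcomp Require Import complex.
From mathcomp Require Import boolp classical_sets functions cardinality reals.

Set Implicit Arguments.
Unset Strict Implicit.
Unset Printing Implicit Defensive.

Import Order.TTheory GRing.Theory Num.Theory.
Local Open Scope ring_scope.
Local Open Scope complex_scope.
Local Open Scope classical_set_scope.

(* Bilinear, not sesquilinear: over the complex numbers there is no
   conjugation, so nonzero vectors may be isotropic. *)
Definition dot (K : comNzRingType) (n : nat) (x y : 'cV[K]_n) : K :=
  \sum_(i < n) x i 0 * y i 0.

Definition complexify (R : realType) (n : nat) (x : 'cV[R]_n) : 'cV[R[i]]_n :=
  map_mx (real_complex R) x.

(* It is a line only when v != 0. *)
Definition line_through (R : realType) (n : nat) (p v : 'cV[R[i]]_n) :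
    set 'cV[R[i]]_n :=
  [set p + t *: v | t in [set: R[i]]].

Definition is_line (R : realType) (n : nat) (L : set 'cV[R[i]]_n) : Prop :=
  exists p v : 'cV[R[i]]_n, v != 0 /\ L = line_through p v.

(* The equation expresses the vanishing of the discriminant of
   (p + t v - c)^2 = r^2 as a quadratic equation in t.  Whether it holds does
   not depend on the choice of p and v: replacing p by p + t v does not change
   the discriminant, and replacing v by s v multiplies it by s^2. *)
Definition tangent_to_sphere (R : realType) (n : nat)
    (c : 'cV[R]_n) (r : R) (L : set 'cV[R[i]]_n) : Prop :=
  exists p v : 'cV[R[i]]_n,
    [/\ v != 0, L = line_through p v &
        let q := p - complexify c in
        dot v q ^+ 2 = dot v v * (dot q q - (r ^+ 2)%:C)].

Definition is_real_line (R : realType) (n : nat) (L : set 'cV[R[i]]_n) : Prop :=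
  exists p v : 'cV[R]_n,
    v != 0 /\ L = line_through (complexify p) (complexify v).

(* Coordinates are numbered from 0, and coordinates of index at least 3 vanish
   because the default value of nth is 0. *)
Definition vec3 (R : realType) (n : nat) (x y z : R) : 'cV[R]_n :=
  \col_(i < n) [:: x; y; z]`_i.

(* With 0-based coordinates, the unit vectors e_4, ..., e_n are the
   delta_mx j 0 with 3 <= j < n. *)
Definition centers (R : realType) (n : nat) (a : R) : seq 'cV[R]_n :=
  [:: vec3 n 1 1 1; vec3 n 1 (-1) (-1); vec3 n (-1) 1 (-1); vec3 n (-1) (-1) 1]
  ++ [seq a *: delta_mx j 0 | j : 'I_n <- enum 'I_n & (3 <= j)%N]
  ++ [seq - (a *: delta_mx j 0) | j : 'I_n <- enum 'I_n & (3 <= j)%N].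

Definition common_tangents (R : realType) (n : nat) (a r : R) :
    set (set 'cV[R[i]]_n) :=
  [set L | is_line L /\
    forall c : 'cV[R]_n, c \in centers n a -> tangent_to_sphere c r L].

Arguments common_tangents {R} n a r _.

Definition gamma (R : realType) (n : nat) (a : R) : R :=
  a ^+ 2 * (n%:R - 1) / (a ^+ 2 + n%:R - 3).

Definition real_region (R : realType) (n : nat) (a r : R) : Prop :=
  [/\ a ^+ 2 > 2, gamma n a < 3 &
      gamma n a < r ^+ 2 < gamma n a + 4^-1 * (3 - gamma n a) ^+ 2].

(* Main.v *)
Require Import Defs.
From HB Require Import structures.
From mathcomp Require Import all_boot all_order all_algebra ring lra.
From mathcomp Require Import complex.
From mathcomp Require Import boolp classical_sets functions cardinality reals.

(** The common tangents can be solved for by hand.  A tangent direction v is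
    never isotropic (touches_all_anisotropic), so the line has a unique point p
    with v.p = 0, and v can be scaled to v.v = 1, which determines it up to
    sign (normalise_line).  Tangency to the sphere centred at c then reads
    (v.c)^2 = p.p - 2 p.c + c.c - r^2.

    For the centres a e_j and - a e_j the left-hand side is the same, a^2 v_j^2,
    so p_j = 0 for j >= 4, and v_j^2 has the same value for all these j.  The
    three coordinates of the centres c_1, ..., c_4, as functions of the index of
    the centre, are the nontrivial characters of the Klein four-group;
    expanding (v.c_i)^2 and comparing Fourier coefficients gives
    p_1 = - v_2 v_3, p_2 = - v_3 v_1, p_3 = - v_1 v_2 and the value of
    v_1^2 + v_2^2 + v_3^2 (tetrahedron_equations).  Hence v.p = - 3 v_1 v_2 v_3, one of v_1, v_2, v_3
    vanishes, and the equation v.v = 1 yields p.p = r^2 - gamma.  What remains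
    (unit_tangentP) is: some v_k with k <= 3 is 0, the squares of the other two
    have sum 3 - gamma and product r^2 - gamma, and
    a^2 v_j^2 = a^2 - gamma for j >= 4.

    The squares are thus the two roots of X^2 - (3 - gamma) X + (r^2 - gamma),
    in one of two orders.  If the roots are distinct and nonzero and
    gamma <> a^2, which means a^2 <> 2, there are 3 choices of k, 2 orders of
    the roots and 2^(n-1) choices of signs; v and - v give the same line,
    which leaves 3 * 2 * 2^(n-1) / 2 = 3 * 2^(n-1) lines.  When all the squares
    are positive reals, v and p are real; the inequalities on a and r ensure
    this, and hold at a^2 = 3, r^2 = gamma + (3 - gamma)^2 / 8.

    Vectors are written in blocks, as col_mx u w with u the first three
    coordinates and w the others. *)

Set Implicit Arguments.
Unset Strict Implicit.
Unset Printing Implicit Defensive.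

Import Order.TTheory GRing.Theory Num.Theory.
Local Open Scope ring_scope.
Local Open Scope classical_set_scope.
Local Open Scope card_scope.

Local Notation "x %:C" := (real_complex _ x).

(** * The bilinear form *)

Section Dot.
Variables (K : comNzRingType).

Lemma dotC n (x y : 'cV[K]_n) : dot x y = dot y x.
Proof. by apply: eq_bigr => i _; rewrite mulrC. Qed.

Lemma dotDl n (x y z : 'cV[K]_n) : dot (x + y) z = dot x z + dot y z.
Proof. by rewrite -big_split; apply: eq_bigr => i _; rewrite mxE mulrDl. Qed.

Lemma dotZl n t (x z : 'cV[K]_n) : dot (t *: x) z = t * dot x z.
Proof. by rewrite mulr_sumr; apply: eq_bigr => i _; rewrite mxE mulrA. Qed.

Lemma dotNl n (x z : 'cV[K]_n) : dot (- x) z = - dot x z.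
Proof. by rewrite -scaleN1r dotZl mulN1r. Qed.

Lemma dotDr n (x y z : 'cV[K]_n) : dot z (x + y) = dot z x + dot z y.
Proof. by rewrite !(dotC z) dotDl. Qed.

Lemma dotZr n t (x z : 'cV[K]_n) : dot z (t *: x) = t * dot z x.
Proof. by rewrite !(dotC z) dotZl. Qed.

Lemma dotNr n (x z : 'cV[K]_n) : dot z (- x) = - dot z x.
Proof. by rewrite !(dotC z) dotNl. Qed.

Definition dotE := (dotDl, dotZl, dotNl, dotDr, dotZr, dotNr).

Lemma dot0r n (x : 'cV[K]_n) : dot x 0 = 0.
Proof. by rewrite /dot big1 // => i _; rewrite mxE mulr0. Qed.

Lemma dot0l n (x : 'cV[K]_n) : dot 0 x = 0.
Proof. by rewrite dotC dot0r. Qed.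

Lemma dot_col_mx m n (u q : 'cV[K]_m) (w z : 'cV[K]_n) :
  dot (col_mx u w) (col_mx q z) = dot u q + dot w z.
Proof.
rewrite /dot big_split_ord /=.
by congr (_ + _); apply: eq_bigr => i _; rewrite ?col_mxEu ?col_mxEd.
Qed.

Lemma dot_delta n (x : 'cV[K]_n) (j : 'I_n) : dot x (delta_mx j 0) = x j 0.
Proof.
rewrite /dot (bigD1 j) //= big1 => [|i /negPf ij]; rewrite mxE ?eqxx ?ij /=.
  by rewrite mulr1 addr0.
by rewrite mulr0.
Qed.

Lemma sum3 (F : 'I_3 -> K) : \sum_(i < 3) F i = F 0 + F 1 + F 2.
Proof.
rewrite !big_ord_recl big_ord0 addr0 addrA.
by congr (F _ + F _ + F _); apply: val_inj.
Qed.

Lemma dot3 (x y : 'cV[K]_3) :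
  dot x y = x 0 0 * y 0 0 + x 1 0 * y 1 0 + x 2 0 * y 2 0.
Proof. exact: sum3. Qed.

Lemma sum3_rot (F : 'I_3 -> K) k : \sum_(i < 3) F i = F k + F (k + 1) + F (k + 2).
Proof.
rewrite sum3.
have [->|->|->] : [\/ k = 0, k = 1 | k = 2].
  by case: k => [[|[|[|//]]] lk];
    [constructor 1 | constructor 2 | constructor 3]; apply: val_inj.
- by rewrite !add0r.
- have -> : 1 + 1 = 2 :> 'I_3 by [].
  have -> : 1 + 2 = 0 :> 'I_3 by apply: val_inj.
  by rewrite -addrA addrC.
have -> : 2 + 1 = 0 :> 'I_3 by apply: val_inj.
have -> : 2 + 2 = 1 :> 'I_3 by apply: val_inj.
by rewrite addrC addrA.
Qed.

(** The tangency equation for an arbitrary representative of the line; r2 is the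
    squared radius, which lets the equation make sense over any ring. *)
Definition touches n (r2 : K) (c p v : 'cV[K]_n) : Prop :=
  dot v (p - c) ^+ 2 = dot v v * (dot (p - c) (p - c) - r2).

(** Moving the base point leaves the discriminant unchanged and rescaling the
    direction by s multiplies it by s^2. *)
Lemma touches_reparam n r2 (c p v : 'cV[K]_n) s t :
  touches r2 c p v -> touches r2 c (p + t *: v) (s *: v).
Proof.
rewrite /touches !dotE => h.
rewrite (dotC c) (dotC c) (dotC p v) in h *.
apply/subr0_eq; move/eqP: h; rewrite -subr_eq0 => /eqP h.
rewrite -[RHS](mulr0 (s ^+ 2)) -h; ring.
Qed.

End Dot.

(** * Indices modulo 3

    The first three coordinates are permuted cyclically by the symmetries of the
    configuration, so they are indexed by the ring 'I_3 of integers modulo 3,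
    and k + 1, k + 2 are the two indices other than k. *)

Lemma ord3P (k i : 'I_3) : [\/ i = k, i = k + 1 | i = k + 2].
Proof.
by case: k i => [[|[|[|//]]] lk] [[|[|[|//]]] li];
  solve [constructor 1; exact: val_inj | constructor 2; exact: val_inj
        | constructor 3; exact: val_inj].
Qed.

Lemma ord3_neq (k : 'I_3) :
  [/\ k + 1 == k = false, k + 2 == k = false & k + 2 == k + 1 = false].
Proof. by case: k => [[|[|[|//]]] lk]. Qed.

Lemma ord3_add (k : 'I_3) :
  [/\ k + 1 + 1 = k + 2, k + 1 + 2 = k, k + 2 + 1 = k & k + 2 + 2 = k + 1].
Proof. by case: k => [[|[|[|//]]] lk]; split; apply: val_inj. Qed.

(** * Lines and their representatives *)

Section Lines.
Variables (R : realType) (n : nat).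
Implicit Types (p v c : 'cV[R[i]]_n).

Lemma line_through_reparam p v s t :
  s != 0 -> line_through (p + t *: v) (s *: v) = line_through p v.
Proof.
move=> s0; apply/seteqP; split=> _ [x _ <-].
  by exists (t + x * s) => //; rewrite scalerDl scalerA addrA.
exists ((x - t) / s) => //.
by rewrite scalerA divfK // scalerBl addrA addrAC addrK.
Qed.

Lemma line_through_eq p v p' v' :
  v != 0 -> v' != 0 -> line_through p v = line_through p' v' ->
  exists s t, [/\ s != 0, v' = s *: v & p' = p + t *: v].
Proof.
move=> v0 v'0 e.
have [t _ pE] : line_through p v p'.
  by rewrite e; exists 0; rewrite // scale0r addr0.
have [s _ sE] : line_through p v (p' + v').
  by rewrite e; exists 1; rewrite // scale1r.
have vE : v' = (s - t) *: v.
  by apply: (addrI p'); rewrite -sE -pE scalerBl [t *: v]lock addrA addrAC -lock addrK.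
exists (s - t), t; split=> //.
by apply: contraNneq v'0 => st; rewrite vE st scale0r.
Qed.

(** By invariance under reparametrisation, the representative of the line that
    is hidden in the definition of tangency may be prescribed. *)
Lemma tangent_to_sphereP (c : 'cV[R]_n) r p v : v != 0 ->
  tangent_to_sphere c r (line_through p v) <->
  touches (r ^+ 2)%:C (complexify c) p v.
Proof.
move=> v0; split=> [[p' [v' [v'0 e h]]]|h]; last by exists p, v.
have [s [t [_ -> ->]]] := line_through_eq v'0 v0 (esym e).
exact: touches_reparam.
Qed.

Lemma common_tangents_line_through a r p v : v != 0 ->
  common_tangents n a r (line_through p v) <->
  forall c : 'cV[R]_n, c \in centers n a ->
    touches (r ^+ 2)%:C (complexify c) p v.
Proof.
move=> v0; split=> [[_ h] c ch|h]; first exact/tangent_to_sphereP/h.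
split; first by exists p, v.
by move=> c ch; apply/tangent_to_sphereP/h.
Qed.

End Lines.

(** * The tangency equations of a normalised line *)

Definition col3 (K : nzRingType) (x y z : K) : 'cV[K]_3 := \col_i [:: x; y; z]`_i.

Lemma dot_col3 (K : comNzRingType) (u : 'cV[K]_3) x y z :
  dot u (col3 x y z) = u 0 0 * x + u 1 0 * y + u 2 0 * z.
Proof. by rewrite dot3 !mxE. Qed.

Section System.
Variables (K : numFieldType) (m : nat) (a r2 : K).
Implicit Types (u q : 'cV[K]_3) (w z : 'cV[K]_m).

(** The centers appear here in block form instead of as a list, which makes the
    equations available over any field and lets dot_col_mx separate the blocks;
    centers_touches_all is the link with the list. *)
Definition touches_all (p v : 'cV[K]_(3 + m)) : Prop :=
  [/\ touches r2 (col_mx (col3 1 1 1) 0) p v,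
      touches r2 (col_mx (col3 1 (-1) (-1)) 0) p v,
      touches r2 (col_mx (col3 (-1) 1 (-1)) 0) p v &
      touches r2 (col_mx (col3 (-1) (-1) 1) 0) p v]
  /\ forall j : 'I_m,
      touches r2 (col_mx 0 (a *: delta_mx j 0)) p v /\
      touches r2 (col_mx 0 (- (a *: delta_mx j 0))) p v.

Lemma isotropic_touches n (c p v : 'cV[K]_n) :
  dot v v = 0 -> touches r2 c p v -> dot v c = dot v p.
Proof.
move=> v0; rewrite /touches v0 mul0r => /eqP.
by rewrite sqrf_eq0 !dotE subr_eq0 => /eqP.
Qed.

(** If v is isotropic, v.c takes the same value at all the centers c.  The
    centers are symmetric about 0 in the last coordinates, so that this value is
    0; but the centers span the whole space, whence v = 0. *)
Lemma touches_all_anisotropic p v : (0 < m)%N -> a != 0 ->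
  touches_all p v -> v != 0 -> dot v v != 0.
Proof.
move=> m0 a0 [[h1 h2 h3 h4] h]; apply: contra_neq => v0.
have K2 : 2%:R != 0 :> K by rewrite pnatr_eq0.
have E := isotropic_touches v0.
move: {h1 h2 h3 h4}(E _ _ h1) (E _ _ h2) (E _ _ h3) (E _ _ h4).
have {E h} : forall j, a * dsubmx v j 0 = dot v p /\ - (a * dsubmx v j 0) = dot v p.
  move=> j; have [/E + /E] := h j.
  by rewrite -{1 3}[v]vsubmxK !dot_col_mx !dotE dot0r !add0r dot_delta.
move: (dot v p) => d h.
have d0 : d = 0.
  have [h1 h2] := h (Ordinal m0).
  by apply: (mulfI K2); rewrite mulr0 mulr2n mulrDl mul1r -{1}h1 -h2 subrr.
rewrite -[v]vsubmxK !dot_col_mx !dot0r !addr0 !dot_col3 d0.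
rewrite !mulr1 !mulrN1 => e1 e2 e3 e4.
rewrite -[RHS]vsubmxK; congr col_mx; last first.
  apply/colP => j; have [e _] := h j.
  by apply: (mulfI a0); rewrite e d0 !mxE mulr0.
have e0 : usubmx v 0 0 = 0.
  apply: (mulfI K2); rewrite mulr0 -[RHS](addr0 0) -[X in X + _]e1 -[X in _ + X]e2.
  by ring.
have e0' : usubmx v 1 0 = 0.
  apply: (mulfI K2); rewrite mulr0 -[RHS](addr0 0) -[X in X + _]e1 -[X in _ + X]e3.
  by ring.
have e0'' : usubmx v 2 0 = 0.
  apply: (mulfI K2); rewrite mulr0 -[RHS](addr0 0) -[X in X + _]e1 -[X in _ + X]e4.
  by ring.
apply/colP => i; rewrite [RHS]mxE [RHS]mxE.
by case: (ord3P 0 i) => ->; rewrite ?add0r.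
Qed.

Lemma touches_normalised n (c p v : 'cV[K]_n) :
  dot v v = 1 -> dot p v = 0 ->
  touches r2 c p v <-> dot v c ^+ 2 = dot p p - 2 * dot p c + dot c c - r2.
Proof.
move=> v1 pv; rewrite /touches !dotE v1 mul1r (dotC v p) pv (dotC c p) sub0r sqrrN.
by split=> ->; ring.
Qed.

(** The base point of a tangent line as a function of the first three
    coordinates of its direction. *)
Definition foot u : 'cV[K]_(3 + m) :=
  col_mx (\col_i - (u (i + 1) 0 * u (i + 2) 0)) 0.

Lemma dot_foot u k : u k 0 = 0 ->
  dot (foot u) (foot u) = (u (k + 1) 0 * u (k + 2) 0) ^+ 2.
Proof.
move=> uk; rewrite /foot dot_col_mx dot0r addr0 /dot (sum3_rot _ k) !mxE.
by have [-> -> -> ->] := ord3_add k; rewrite uk; ring.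
Qed.

(** Inversion of the Fourier transform of the Klein four-group: the sign vectors
    c of the four equations satisfy c_0 c_1 = c_2 and its cyclic analogues, so
    (u.c)^2 = u.u + 2 (u_1 u_2 c_0 + u_2 u_0 c_1 + u_0 u_1 c_2), and the four
    equations identify the coefficients of 1, c_0, c_1, c_2 on both sides. *)
Lemma tetrahedron_equations (u0 u1 u2 q0 q1 q2 Q : K) :
  [/\ (u0 + u1 + u2) ^+ 2 = Q - 2 * (q0 + q1 + q2),
      (u0 - u1 - u2) ^+ 2 = Q - 2 * (q0 - q1 - q2),
      (- u0 + u1 - u2) ^+ 2 = Q - 2 * (- q0 + q1 - q2) &
      (- u0 - u1 + u2) ^+ 2 = Q - 2 * (- q0 - q1 + q2)]
  <-> [/\ u0 * u0 + u1 * u1 + u2 * u2 = Q,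
          q0 = - (u1 * u2), q1 = - (u2 * u0) & q2 = - (u0 * u1)].
Proof.
split=> [[h1 h2 h3 h4]|[<- -> -> ->]]; last by split; ring.
have K4 : 4%:R != 0 :> K by rewrite pnatr_eq0.
split; apply: (mulfI K4); apply/subr0_eq.
- transitivity (((u0 + u1 + u2) ^+ 2 - (Q - 2 * (q0 + q1 + q2)))
   + ((u0 - u1 - u2) ^+ 2 - (Q - 2 * (q0 - q1 - q2)))
   + ((- u0 + u1 - u2) ^+ 2 - (Q - 2 * (- q0 + q1 - q2)))
   + ((- u0 - u1 + u2) ^+ 2 - (Q - 2 * (- q0 - q1 + q2)))).
    by ring.
  by rewrite h1 h2 h3 h4; ring.
- transitivity ((((u0 + u1 + u2) ^+ 2 - (Q - 2 * (q0 + q1 + q2)))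
   + ((u0 - u1 - u2) ^+ 2 - (Q - 2 * (q0 - q1 - q2)))
   - ((- u0 + u1 - u2) ^+ 2 - (Q - 2 * (- q0 + q1 - q2)))
   - ((- u0 - u1 + u2) ^+ 2 - (Q - 2 * (- q0 - q1 + q2)))) / 2).
    by field.
  by rewrite h1 h2 h3 h4; ring.
- transitivity ((((u0 + u1 + u2) ^+ 2 - (Q - 2 * (q0 + q1 + q2)))
   - ((u0 - u1 - u2) ^+ 2 - (Q - 2 * (q0 - q1 - q2)))
   + ((- u0 + u1 - u2) ^+ 2 - (Q - 2 * (- q0 + q1 - q2)))
   - ((- u0 - u1 + u2) ^+ 2 - (Q - 2 * (- q0 - q1 + q2)))) / 2).
    by field.
  by rewrite h1 h2 h3 h4; ring.
- transitivity ((((u0 + u1 + u2) ^+ 2 - (Q - 2 * (q0 + q1 + q2)))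
   - ((u0 - u1 - u2) ^+ 2 - (Q - 2 * (q0 - q1 - q2)))
   - ((- u0 + u1 - u2) ^+ 2 - (Q - 2 * (- q0 + q1 - q2)))
   + ((- u0 - u1 + u2) ^+ 2 - (Q - 2 * (- q0 - q1 + q2)))) / 2).
    by field.
  by rewrite h1 h2 h3 h4; ring.
Qed.

Section Normalised.
Variables (u q : 'cV[K]_3) (w z : 'cV[K]_m).
Let v := col_mx u w.
Let p := col_mx q z.
Hypotheses (vv : dot v v = 1) (pv : dot p v = 0).

(** The sum and the difference of the two equations separate w from z. *)
Lemma touches_poles j : a != 0 ->
  touches r2 (col_mx 0 (a *: delta_mx j 0)) p v /\
  touches r2 (col_mx 0 (- (a *: delta_mx j 0))) p v <->
  z j 0 = 0 /\ a ^+ 2 * w j 0 ^+ 2 = dot p p + a ^+ 2 - r2.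
Proof.
move=> a0; set P := dot p p.
rewrite !touches_normalised // -/P !dot_col_mx !dotE !dot0r !dot_delta !mxE !eqxx.
rewrite !add0r mulr1; split=> [[h1 h2]|[-> h]]; last first.
  by rewrite sqrrN exprMn h; split; ring.
have K4 : 4%:R != 0 :> K by rewrite pnatr_eq0.
have zj : z j 0 = 0.
  apply: (mulfI K4); apply: (mulfI a0); rewrite !mulr0.
  transitivity ((a * w j 0) ^+ 2 - (P - 2 * (a * z j 0) + a * a - r2)
    - ((- (a * w j 0)) ^+ 2 - (P - 2 * - (a * z j 0) - a * - a - r2))).
    by ring.
  by rewrite h1 h2; ring.
by split=> //; rewrite -exprMn h1 zj; ring.
Qed.

Lemma touches_tetrahedron :
  [/\ touches r2 (col_mx (col3 1 1 1) 0) p v,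
      touches r2 (col_mx (col3 1 (-1) (-1)) 0) p v,
      touches r2 (col_mx (col3 (-1) 1 (-1)) 0) p v &
      touches r2 (col_mx (col3 (-1) (-1) 1) 0) p v] <->
  q = usubmx (foot u) /\ dot u u = dot p p + 3 - r2.
Proof.
set P := dot p p.
have vertex x y t : x * x + y * y + t * t = 3 ->
   touches r2 (col_mx (col3 x y t) 0) p v <->
   (u 0 0 * x + u 1 0 * y + u 2 0 * t) ^+ 2 =
     P + 3 - r2 - 2 * (q 0 0 * x + q 1 0 * y + q 2 0 * t).
  move=> <-.
  rewrite touches_normalised // -/P !dot_col_mx !dot0r !addr0 !dot_col3 !mxE /=.
  by split=> ->; ring.
have [c1 c2 c3 c4] :
    [/\ 1 * 1 + 1 * 1 + 1 * 1 = 3 :> K, 1 * 1 + -1 * -1 + -1 * -1 = 3 :> K,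
        -1 * -1 + 1 * 1 + -1 * -1 = 3 :> K & -1 * -1 + -1 * -1 + 1 * 1 = 3 :> K].
  by split; ring.
move: (vertex _ _ _ c1) (vertex _ _ _ c2) (vertex _ _ _ c3) (vertex _ _ _ c4).
rewrite !mulr1 !mulrN1 => H1 H2 H3 H4.
have T := tetrahedron_equations (u 0 0) (u 1 0) (u 2 0)
            (q 0 0) (q 1 0) (q 2 0) (P + 3 - r2).
rewrite -dot3 in T; rewrite /foot col_mxKu.
have [] := ord3_add 0; rewrite !add0r => i11 i12 i21 i22.
split=> [[/H1 h1 /H2 h2 /H3 h3 /H4 h4]|[qE uu]].
  have [//|-> e0 e1 e2] := T.1; split=> //.
  apply/colP => i; rewrite mxE.
  by case: (ord3P 0 i) => ->; rewrite ?add0r ?i11 ?i12 ?i21 ?i22.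
have [|h1 h2 h3 h4] := T.2; last by split; [apply/H1|apply/H2|apply/H3|apply/H4].
by rewrite qE !mxE ?add0r ?i11 ?i12 ?i21 ?i22.
Qed.

Lemma touches_all_normalised : a != 0 ->
  touches_all p v <->
  [/\ p = foot u, dot u u = dot p p + 3 - r2 &
      forall j, a ^+ 2 * w j 0 ^+ 2 = dot p p + a ^+ 2 - r2].
Proof.
move=> a0; rewrite /touches_all touches_tetrahedron.
split=> [[[qE uu] h]|[pE uu h]].
  have {}h j := (touches_poles j a0).1 (h j).
  split=> // [|j]; last by case: (h j).
  rewrite /p qE /foot col_mxKu; congr col_mx.
  by apply/colP => j; have [-> _] := h j; rewrite mxE.
have [qE zE] : q = usubmx (foot u) /\ z = 0.
  by rewrite /foot col_mxKu; apply: eq_col_mx.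
by split=> // j; apply/touches_poles; rewrite ?zE ?mxE.
Qed.

End Normalised.

End System.

(** * Directions of the common tangents *)

Section Directions.
Variables (K : numFieldType) (m : nat) (a r2 g : K).
Hypotheses (a0 : a != 0) (ad0 : a ^+ 2 + m.+1%:R != 0).
Hypothesis gE : g * (a ^+ 2 + m.+1%:R) = a ^+ 2 * (m.+1%:R + 2).

Definition unit_direction (u : 'cV[K]_3) (w : 'cV[K]_m.+1) (k : 'I_3) : Prop :=
  [/\ u k 0 = 0, u (k + 1) 0 ^+ 2 + u (k + 2) 0 ^+ 2 = 3 - g,
      (u (k + 1) 0 * u (k + 2) 0) ^+ 2 = r2 - g &
      forall j, a ^+ 2 * w j 0 ^+ 2 = a ^+ 2 - g].

Lemma dot_zero_coord (u : 'cV[K]_3) k : u k 0 = 0 ->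
  dot u u = u (k + 1) 0 ^+ 2 + u (k + 2) 0 ^+ 2.
Proof. by move=> uk; rewrite /dot (sum3_rot _ k) uk mul0r add0r -!expr2. Qed.

Lemma dot_foot_l (u : 'cV[K]_3) (w : 'cV[K]_m.+1) :
  dot (foot _ u) (col_mx u w) = - (3 * (u 0 0 * u 1 0 * u 2 0)).
Proof.
rewrite dot_col_mx dot0l addr0 dot3 !mxE !add0r.
by have [] := ord3_add 0; rewrite !add0r => -> -> -> ->; ring.
Qed.

Lemma dot_axes (w : 'cV[K]_m.+1) c :
  (forall j, a ^+ 2 * w j 0 ^+ 2 = c) -> a ^+ 2 * dot w w = m.+1%:R * c.
Proof.
move=> h; rewrite /dot mulr_sumr.
under eq_bigr => j _ do rewrite -expr2 h.
by rewrite sumr_const card_ord mulr_natl.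
Qed.

(** Inserting the values of u.u and w.w in terms of p.p into v.v = 1 gives a
    linear equation for p.p, with solution r2 - g.  The orthogonality v.p = 0
    is the vanishing of one of the first three coordinates of v. *)
Lemma unit_tangentP (p : 'cV[K]_(3 + m.+1)) u w :
  let v := col_mx u w in
  [/\ dot v v = 1, dot p v = 0 & touches_all a r2 p v] <->
  p = foot _ u /\ exists k, unit_direction u w k.
Proof.
move=> v; split=> [[vv pv]|[-> [k [uk hs hp ht]]]].
  rewrite -[p]vsubmxK in pv *.
  rewrite touches_all_normalised // vsubmxK => -[pE uu ww].
  have ww' := dot_axes ww.
  have PE : dot p p = r2 - g.
    move: vv; rewrite dot_col_mx uu => vv.
    apply/subr0_eq/(mulIf ad0); rewrite mul0r.
    transitivity (a ^+ 2 * (dot p p + 3 - r2 + dot w w - 1)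
      - (a ^+ 2 * dot w w - m.+1%:R * (dot p p + a ^+ 2 - r2))
      + (g * (a ^+ 2 + m.+1%:R) - a ^+ 2 * (m.+1%:R + 2))).
      by ring.
    by rewrite vv ww' gE; ring.
  rewrite vsubmxK in pv; split=> //.
  have [k uk] : exists k, u k 0 = 0.
    have /eqP : 3 * (u 0 0 * u 1 0 * u 2 0) = 0.
      by apply/eqP; rewrite -oppr_eq0 -(dot_foot_l u w) -pE pv.
    rewrite !mulf_eq0 pnatr_eq0 /= => /orP[/orP[]|] /eqP;
      by [exists 0 | exists 1 | exists 2].
  exists k; split=> // [||j]; last by rewrite ww PE; ring.
    by rewrite -dot_zero_coord // uu PE; ring.
  by rewrite -(dot_foot m.+1 uk) -pE.
have uu : dot u u = 3 - g by rewrite (dot_zero_coord uk).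
have PE : dot (foot m.+1 u) (foot m.+1 u) = r2 - g by rewrite (dot_foot _ uk).
have vv : dot v v = 1.
  have ww' := dot_axes ht.
  have a20 : a ^+ 2 != 0 by rewrite expf_eq0.
  rewrite dot_col_mx uu; apply/subr0_eq/(mulfI a20); rewrite mulr0.
  transitivity ((a ^+ 2 * dot w w - m.+1%:R * (a ^+ 2 - g))
      - (g * (a ^+ 2 + m.+1%:R) - a ^+ 2 * (m.+1%:R + 2))).
    by ring.
  by rewrite ww' gE; ring.
have pv : dot (foot m.+1 u) v = 0.
  rewrite dot_foot_l.
  have -> : u 0 0 * u 1 0 * u 2 0 = 0; last by rewrite mulr0 oppr0.
  by case: (ord3P 0 k) uk => ->; rewrite ?add0r => ->; rewrite ?mulr0 ?mul0r.
split=> //; apply/touches_all_normalised => //.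
by split=> // [|j]; rewrite PE ?uu ?ht; ring.
Qed.

Variables (alpha beta delta : K).

(** A parameter (k, e, f) describes a direction up to sign.  Its coordinate k is
    zero, so that e k is free to encode the order of alpha and beta at k + 1 and
    k + 2; the other values of e and the values of f are signs.  The first
    coordinate of the second block is delta, without a sign: this selects one of
    v and - v. *)
Definition parameter : Type :=
  ('I_3 * {ffun 'I_3 -> bool} * {ffun 'I_m -> bool})%type.

Definition tetra_part (x : parameter) : 'cV[K]_3 :=
  \col_i let: (k, e, _) := x in
    if i == k then 0
    else (-1) ^+ e i * (if (i == k + 1) (+) e k then alpha else beta).

Definition axes_part (x : parameter) : 'cV[K]_m.+1 :=
  \col_j ((-1) ^+ oapp x.2 false (unlift 0 j) * delta).

Hypotheses (hs : alpha ^+ 2 + beta ^+ 2 = 3 - g)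
  (hp : (alpha * beta) ^+ 2 = r2 - g) (ht : a ^+ 2 * delta ^+ 2 = a ^+ 2 - g).

Lemma tetra_part_coords k e f :
  [/\ tetra_part (k, e, f) k 0 = 0,
      tetra_part (k, e, f) (k + 1) 0 =
        (-1) ^+ e (k + 1) * (if e k then beta else alpha) &
      tetra_part (k, e, f) (k + 2) 0 =
        (-1) ^+ e (k + 2) * (if e k then alpha else beta)].
Proof.
have [n1 n2 n3] := ord3_neq k.
by rewrite !mxE eqxx n1 n2 n3 eqxx addFb addTb; case: (e k).
Qed.

Lemma parameter_direction x : unit_direction (tetra_part x) (axes_part x) x.1.1.
Proof.
case: x => [[k e] f]; rewrite /unit_direction /=.
have [-> -> ->] := tetra_part_coords k e f.
split=> // [||j]; rewrite ?exprMn ?sqrr_sign ?mul1r -?hs -?hp.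
- by case: (e k) => //; rewrite addrC.
- by case: (e k) => //; rewrite exprMn // mulrC.
- by rewrite mxE exprMn sqrr_sign mul1r.
Qed.

Lemma eqf_sign (x y : K) : x ^+ 2 = y ^+ 2 -> x = (-1) ^+ (x != y) * y.
Proof.
move/eqP; rewrite eqf_sqr; case: eqVneq => [-> _|_ /= /eqP ->].
  by rewrite mul1r.
by rewrite mulN1r.
Qed.

(** Each of the two squares is a root of the polynomial
    (X - alpha ^+ 2) (X - beta ^+ 2), and determines the other one. *)
Lemma direction_parameter u w k : unit_direction u w k -> w 0 0 = delta ->
  exists x, u = tetra_part x /\ w = axes_part x.
Proof.
move=> [uk us up wt] w0.
(* b tells which root belongs to k + 1 *)
have [b [e1 e2]] : exists b : bool,
    u (k + 1) 0 ^+ 2 = (if b then beta else alpha) ^+ 2 /\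
    u (k + 2) 0 ^+ 2 = (if b then alpha else beta) ^+ 2.
  have : (u (k + 1) 0 ^+ 2 - alpha ^+ 2) * (u (k + 1) 0 ^+ 2 - beta ^+ 2) = 0.
    transitivity (u (k + 1) 0 ^+ 2 * (u (k + 1) 0 ^+ 2 + u (k + 2) 0 ^+ 2
        - (alpha ^+ 2 + beta ^+ 2)) - ((u (k + 1) 0 * u (k + 2) 0) ^+ 2
        - (alpha * beta) ^+ 2)).
      by ring.
    by rewrite us up hs hp !subrr mulr0 subr0.
  move/eqP; rewrite mulf_eq0 !subr_eq0 => /orP[] /eqP e1.
    exists false; split=> //; apply: (addrI (u (k + 1) 0 ^+ 2)).
    by rewrite us e1 /= hs.
  exists true; split=> //; apply: (addrI (u (k + 1) 0 ^+ 2)).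
  by rewrite us e1 /= [RHS]addrC hs.
have [n1 n2 n3] := ord3_neq k.
pose e := [ffun i => if i == k then b
  else u i 0 != if (i == k + 1) (+) b then alpha else beta].
pose f := [ffun j : 'I_m => w (lift 0 j) 0 != delta].
exists (k, e, f); split.
  have [h0 h1 h2] := tetra_part_coords k e f.
  apply/colP => i; case: (ord3P k i) => ->.
  - by rewrite uk h0.
  - by rewrite h1 !ffunE !eqxx n1 addTb if_neg; apply: eqf_sign.
  - by rewrite h2 !ffunE !eqxx n2 n3 addFb; apply: eqf_sign.
apply/colP => j; rewrite mxE /=; case: unliftP => [i ->|-> /=]; last by rewrite mul1r.
rewrite /= ffunE; apply: eqf_sign.
have a20 : a ^+ 2 != 0 by rewrite expf_eq0.
by apply: (mulfI a20); rewrite wt ht.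
Qed.

Hypotheses (alpha0 : alpha != 0) (beta0 : beta != 0) (delta0 : delta != 0)
  (ab : alpha ^+ 2 != beta ^+ 2).

Lemma sign_inj (x : K) (b c : bool) :
  x != 0 -> (-1) ^+ b * x = (-1) ^+ c * x -> b = c.
Proof. by move=> x0 /(mulIf x0)/eqP; rewrite (inj_eq signr_inj) => /eqP. Qed.

(** k is recovered as the only zero among the first three coordinates, e k from
    the square of the coordinate k + 1, and the signs from the rest. *)
Lemma parameter_inj x y :
  tetra_part x = tetra_part y -> axes_part x = axes_part y -> x = y.
Proof.
case: x y => [[k e] f] [[k' e'] f'] hE tE.
have kE : k = k'.
  apply/eqP; move/colP/(_ k): hE; rewrite !mxE eqxx; case: ifP => // _ /esym/eqP.
  by rewrite mulf_eq0 signr_eq0 /=; case: ifP => _ /eqP E;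
    move: alpha0 beta0; rewrite E eqxx.
rewrite -{k'}kE in hE tE *.
have ekE : e k = e' k.
  have [_ h1 _] := tetra_part_coords k e f; have [_ h1' _] := tetra_part_coords k e' f'.
  move: h1; rewrite hE h1' => /(congr1 (fun x => x ^+ 2)).
  rewrite !exprMn !sqrr_sign !mul1r.
  by case: (e k) (e' k) => -[] // /eqP; rewrite ?(negPf ab) // eq_sym (negPf ab).
congr (_, _, _); apply/ffunP => i.
  have [->//|ik] := eqVneq i k.
  move/colP/(_ i): hE; rewrite !mxE (negPf ik) ekE; apply: sign_inj.
  by case: ifP.
move/colP/(_ (lift 0 i)): tE; rewrite !mxE /= liftK; exact: sign_inj.
Qed.

End Directions.

(** * Complex common tangents *)

Section Tangents.
Variable R : realType.

Lemma complexify_vec3 m (x y z : R) :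
  complexify (vec3 (3 + m) x y z) = col_mx (col3 x%:C y%:C z%:C) 0.
Proof.
apply/colP => i; rewrite !mxE; case: splitP => j -> ; rewrite !mxE.
  by case: j => [[|[|[|]]]].
by rewrite nth_default ?rmorph0.
Qed.

Lemma complexify_pole m (a : R) (j : 'I_m) :
  complexify (a *: delta_mx (rshift 3 j) 0) = col_mx 0 (a%:C *: delta_mx j 0).
Proof.
apply/colP => i; rewrite !mxE; case: (split_ordP i) => k ->; rewrite !mxE.
  by rewrite eq_lrshift mulr0 rmorph0.
by rewrite eq_rshift rmorphM /= rmorph_nat.
Qed.

Lemma complexifyN n (x : 'cV[R]_n) : complexify (- x) = - complexify x.
Proof. exact: map_mxN. Qed.

Lemma centers_touches_all m (a r2 : R) (p v : 'cV[R[i]]_(3 + m)) :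
  (forall c : 'cV[R]_(3 + m), c \in centers (3 + m) a ->
     touches r2%:C (complexify c) p v) <->
  touches_all a%:C r2%:C p v.
Proof.
have poleN (j : 'I_m) : complexify (- (a *: delta_mx (rshift 3 j) 0)) =
    col_mx 0 (- (a%:C *: delta_mx j 0)).
  by rewrite complexifyN complexify_pole opp_col_mx oppr0.
have pole_index (i : 'I_(3 + m)) : (3 <= i)%N -> exists j, i = rshift 3 j.
  case: (split_ordP i) => j -> i3; last by exists j.
  by have := ltn_ord j; rewrite ltnNge (i3 : (3 <= j)%N).
have C1 : 1%:C = 1 :> R[i] by rewrite rmorph1.
have CN1 : (-1)%:C = -1 :> R[i] by rewrite rmorphN1.
split=> [h|[[h1 h2 h3 h4] h] c].
  split=> [|j]; last first.
    rewrite -complexify_pole -poleN; split; apply: h;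
      rewrite mem_cat mem_cat; apply/orP; right; apply/orP; [left | right];
      by apply/mapP; exists (rshift 3 j); rewrite // mem_filter mem_enum.
  by split; rewrite -?CN1 -?C1 -complexify_vec3; apply: h; rewrite !inE eqxx ?orbT.
rewrite mem_cat mem_cat !inE => /orP[|/orP[]].
- move=> /or4P[] /eqP ->; rewrite complexify_vec3 ?rmorphN1 ?rmorph1;
    [exact: h1 | exact: h2 | exact: h3 | exact: h4].
- case/mapP => i; rewrite mem_filter => /andP[/pole_index[j ->] _ ->].
  rewrite complexify_pole; exact: (h j).1.
- case/mapP => i; rewrite mem_filter => /andP[/pole_index[j ->] _ ->].
  rewrite poleN; exact: (h j).2.
Qed.

Lemma normalise_line n (p v : 'cV[R[i]]_n) : dot v v != 0 ->
  exists p' v', [/\ line_through p v = line_through p' v',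
                    dot v' v' = 1 & dot p' v' = 0].
Proof.
move=> vv; pose s := (sqrtC (dot v v))^-1.
have s0 : s != 0 by rewrite invr_eq0 sqrtC_eq0.
have s2 : s ^+ 2 = (dot v v)^-1 by rewrite exprVn sqrtCK.
exists (p + - (dot p v / dot v v) *: v), (s *: v); split.
- by rewrite line_through_reparam.
- by rewrite !dotE mulrA -expr2 s2 mulVf.
by rewrite !dotE; field.
Qed.

Lemma unit_neq0 k (v : 'cV[R[i]]_k) : dot v v = 1 -> v != 0.
Proof. by apply: contra_eqN => /eqP ->; rewrite dot0r eq_sym oner_eq0. Qed.

Section Count.
Variables (m : nat) (a r : R) (a_gt0 : 0 < a).
Let n := (3 + m.+1)%N.
Let g := gamma n a.

Lemma gamma_eq : g * (a ^+ 2 + m.+1%:R) = a ^+ 2 * (m.+1%:R + 2).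
Proof.
have d0 : a ^+ 2 + m.+1%:R != 0 by rewrite gt_eqF // addr_gt0 ?exprn_gt0.
rewrite /g /gamma /n natrD.
have -> : a ^+ 2 + (3 + m.+1%:R) - 3 = a ^+ 2 + m.+1%:R by ring.
by rewrite divfK //; ring.
Qed.

Variables alpha beta delta : R[i].
Hypotheses (hs : alpha ^+ 2 + beta ^+ 2 = 3 - g%:C)
  (hp : (alpha * beta) ^+ 2 = (r ^+ 2)%:C - g%:C)
  (ht : a%:C ^+ 2 * delta ^+ 2 = a%:C ^+ 2 - g%:C).

Definition tangent (x : parameter m) : set 'cV[R[i]]_n :=
  line_through (foot m.+1 (tetra_part alpha beta x))
    (col_mx (tetra_part alpha beta x) (axes_part delta x)).

Let aC0 : a%:C != 0.
Proof. by rewrite fmorph_eq0 gt_eqF. Qed.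

Let adC0 : a%:C ^+ 2 + m.+1%:R != 0.
Proof.
rewrite -rmorphXn -(rmorph_nat (real_complex R)) -rmorphD fmorph_eq0.
by rewrite gt_eqF // addr_gt0 ?exprn_gt0.
Qed.

Let gCE : g%:C * (a%:C ^+ 2 + m.+1%:R) = a%:C ^+ 2 * (m.+1%:R + 2).
Proof.
have := congr1 (real_complex R) gamma_eq.
by rewrite !(rmorphM, rmorphD, rmorphXn) /= !rmorph_nat.
Qed.

Let unitP := unit_tangentP (r ^+ 2)%:C aC0 adC0 gCE.

Lemma tangent_normalised x :
  let p := foot m.+1 (tetra_part alpha beta x) in
  let v := col_mx (tetra_part alpha beta x) (axes_part delta x) in
  [/\ dot v v = 1, dot p v = 0 & touches_all a%:C (r ^+ 2)%:C p v].
Proof.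
by apply/unitP; split=> //; exists x.1.1; apply: parameter_direction.
Qed.

(** A normalised direction is unique up to sign, and the sign is adjusted so that
    the first coordinate of the second block becomes delta. *)
Lemma tangentP L : common_tangents n a r L <-> exists x, L = tangent x.
Proof.
split=> [tL|[x ->]]; last first.
  have [vv _ h] := tangent_normalised x.
  by apply/common_tangents_line_through; [exact: unit_neq0 | apply/centers_touches_all].
have [[p [v [v0 LE]]] _] := tL.
have vv : dot v v != 0.
  move: tL; rewrite LE => /common_tangents_line_through -/(_ v0)/centers_touches_all h.
  exact: touches_all_anisotropic h v0.
have {vv} [q [d [pdE dd qd]]] := normalise_line p vv.
rewrite LE pdE in tL *.
move: tL => /common_tangents_line_through -/(_ (unit_neq0 dd))/centers_touches_all h.
rewrite -[d]vsubmxK in dd qd h *.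
have [-> [k s]] := (unitP _ _ _).1 (And3 dd qd h).
move: (usubmx d) (dsubmx d) s => u w s.
have : w 0 0 ^+ 2 = delta ^+ 2.
  have a20 : a%:C ^+ 2 != 0 by rewrite expf_eq0.
  by case: s => _ _ _ /(_ 0) E; apply: (mulfI a20); rewrite E ht.
move/eqP; rewrite eqf_sqr => /orP[] /eqP w0.
  by have [x [-> ->]] := direction_parameter aC0 hs hp ht s w0; exists x.
(* now w 0 0 = - delta, and the direction is reversed *)
have fE : foot m.+1 u = foot m.+1 (- u).
  by congr col_mx; apply/colP => i; rewrite !mxE mulrNN.
have s' : unit_direction a%:C (r ^+ 2)%:C g%:C (- u) (- w) k.
  case: s => uk us up wt; split=> [|||j]; rewrite !mxE ?uk ?oppr0 ?mulrNN ?sqrrN //.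
have [|x [uE wE]] := direction_parameter aC0 hs hp ht s'.
  by rewrite mxE w0 opprK.
exists x; rewrite /tangent -uE -wE fE.
rewrite -opp_col_mx -[- col_mx _ _]scaleN1r -[foot m.+1 (- u)](addr0).
rewrite -[X in _ + X](scale0r (col_mx u w)).
by rewrite line_through_reparam ?scale0r ?addr0 ?oppr_eq0 ?oner_eq0.
Qed.

Hypotheses (rg : r ^+ 2 != g) (a2 : a ^+ 2 != 2)
  (disc : (3 - g) ^+ 2 + 4 * g - 4 * r ^+ 2 != 0).

(** Equal lines have unit directions that agree up to a factor s, and s = 1
    because both directions have the coordinate delta <> 0. *)
Lemma tangent_inj : injective tangent.
Proof.
have ab0 : (alpha * beta) ^+ 2 != 0 by rewrite hp -rmorphB fmorph_eq0 subr_eq0.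
have alpha0 : alpha != 0 by apply: contraNneq ab0 => ->; rewrite mul0r expr0n.
have beta0 : beta != 0 by apply: contraNneq ab0 => ->; rewrite mulr0 expr0n.
have ab : alpha ^+ 2 != beta ^+ 2.
  apply: contraNneq disc => abE; rewrite -(fmorph_eq0 (real_complex R)) /=.
  have -> : ((3 - g) ^+ 2 + 4 * g - 4 * r ^+ 2)%:C =
      (3 - g%:C) ^+ 2 - 4 * ((r ^+ 2)%:C - g%:C).
    have c3 : 3%:C = 3 :> R[i] by exact: rmorph_nat.
    have c4 : 4%:C = 4 :> R[i] by exact: rmorph_nat.
    by rewrite -c3 -c4 -!(rmorphB, rmorphM, rmorphXn); congr (_%:C); ring.
  apply/eqP; rewrite -hs -hp exprMn abE; ring.
have delta0 : delta != 0.
  apply: contra_neq a2 => d0.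
  move: ht; rewrite d0 expr0n mulr0 -rmorphXn => /esym/eqP.
  rewrite subr_eq0 => /eqP/complexI ag.
  have a20 : a ^+ 2 != 0 by rewrite expf_eq0 gt_eqF.
  by have := gamma_eq; rewrite -ag => /(mulfI a20); lra.
move=> x y xy.
have [vx _ _] := tangent_normalised x; have [vy _ _] := tangent_normalised y.
have [s [t [s0 vE _]]] := line_through_eq (unit_neq0 vx) (unit_neq0 vy) xy.
have s1 : s = 1.
  have := congr1 (fun v : 'cV_n => v (rshift 3 0) 0) vE.
  rewrite [RHS]mxE !col_mxEd !mxE unlift_none /= mul1r => /eqP.
  by rewrite -{1}[delta]mul1r (inj_eq (mulIf delta0)) => /eqP.
move: vE; rewrite s1 scale1r => /eq_col_mx[hE tE].
by apply: (parameter_inj alpha0 beta0 delta0 ab).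
Qed.

Lemma common_tangents_card : common_tangents n a r #= `I_(3 * 2 ^ n.-1).
Proof.
have cE : #|{: parameter m}| = (3 * 2 ^ n.-1)%N.
  rewrite !card_prod !card_ffun !card_ord card_bool -mulnA -expnD.
  by rewrite /n addnS.
rewrite -cE card_eq_sym (card_eq_trans card_II) //.
apply/card_set_bijP; exists (fun i : 'I_#|{: parameter m}| => tangent (enum_val i)).
split=> [i _|i j _ _ /tangent_inj/enum_val_inj//|L /tangentP[x ->]].
  by apply/tangentP; exists (enum_val i).
exists (enum_rank x); [exact: I | exact: (congr1 tangent (enum_rankK x))].
Qed.

End Count.

End Tangents.

(** * Real common tangents *)

Lemma two_squares_closed (K : numClosedFieldType) (S Q : K) :
  exists alpha beta, alpha ^+ 2 + beta ^+ 2 = S /\ (alpha * beta) ^+ 2 = Q.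
Proof.
pose D := sqrtC (S ^+ 2 - 4 * Q).
have DE : D ^+ 2 = S ^+ 2 - 4 * Q by rewrite sqrtCK.
exists (sqrtC ((S + D) / 2)), (sqrtC ((S - D) / 2)).
rewrite exprMn !sqrtCK; split; first by field.
transitivity ((S ^+ 2 - D ^+ 2) / 4); first by field.
by rewrite DE; field.
Qed.

(** Positive sum and product and a nonnegative discriminant make both roots of
    X^2 - S X + Q real and nonnegative, hence squares. *)
Lemma two_squares_real (R : rcfType) (S Q : R) :
  0 < S -> 0 < Q -> 0 <= S ^+ 2 - 4 * Q ->
  exists alpha beta, alpha ^+ 2 + beta ^+ 2 = S /\ (alpha * beta) ^+ 2 = Q.
Proof.
move=> S0 Q0 D0; pose D := Num.sqrt (S ^+ 2 - 4 * Q).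
have DE : D ^+ 2 = S ^+ 2 - 4 * Q by rewrite sqr_sqrtr.
have Dge0 : 0 <= D by rewrite sqrtr_ge0.
have DS : D <= S by rewrite -ler_sqr ?nnegrE ?(ltW S0) // DE; lra.
exists (Num.sqrt ((S + D) / 2)), (Num.sqrt ((S - D) / 2)).
rewrite exprMn !sqr_sqrtr; [|lra|lra]; split; first by field.
transitivity ((S ^+ 2 - D ^+ 2) / 4); first by field.
by rewrite DE; field.
Qed.

Section Real.
Variables (R : realType) (m : nat).

Lemma map_tetra_part (alpha beta : R) (x : parameter m) :
  tetra_part alpha%:C beta%:C x = map_mx (real_complex R) (tetra_part alpha beta x).
Proof.
case: x => [[k e] f]; apply/colP => i; rewrite !mxE.
by case: ifP => _; rewrite ?rmorph0 // rmorphM rmorph_sign; case: ifP.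
Qed.

Lemma map_axes_part (delta : R) (x : parameter m) :
  axes_part delta%:C x = map_mx (real_complex R) (axes_part delta x).
Proof. by apply/colP => j; rewrite !mxE rmorphM rmorph_sign. Qed.

Lemma map_foot k (u : 'cV[R]_3) :
  foot k (map_mx (real_complex R) u) = map_mx (real_complex R) (foot k u).
Proof.
rewrite /foot map_col_mx map_mx0; congr col_mx; apply/colP => i.
by rewrite !mxE rmorphN rmorphM.
Qed.

Lemma tangent_real (alpha beta delta : R) (x : parameter m) :
  col_mx (tetra_part alpha%:C beta%:C x) (axes_part delta%:C x) != 0 ->
  is_real_line (tangent alpha%:C beta%:C delta%:C x).
Proof.
set v := col_mx (tetra_part alpha beta x) (axes_part delta x).
have -> : col_mx (tetra_part alpha%:C beta%:C x) (axes_part delta%:C x) = complexify v.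
  by rewrite map_tetra_part map_axes_part -map_col_mx.
move=> v0; exists (foot m.+1 (tetra_part alpha beta x)), v; split.
  by apply: contraNneq v0 => ->; rewrite /complexify map_mx0.
by rewrite /tangent map_tetra_part map_axes_part -map_col_mx map_foot.
Qed.

End Real.

Lemma generic_common_tangents_card (R : realType) (m : nat) (a r : R)
    (g := gamma (3 + m.+1) a) :
  0 < a -> r ^+ 2 != g -> a ^+ 2 != 2 ->
  (3 - g) ^+ 2 + 4 * g - 4 * r ^+ 2 != 0 ->
  common_tangents (3 + m.+1) a r #= `I_(3 * 2 ^ (3 + m)).
Proof.
move=> a_gt0 rg a2 disc.
have [alpha [beta [hs hp]]] := two_squares_closed (3 - g%:C) ((r ^+ 2)%:C - g%:C).
pose delta := sqrtC ((a%:C ^+ 2 - g%:C) / a%:C ^+ 2).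
have ht : a%:C ^+ 2 * delta ^+ 2 = a%:C ^+ 2 - g%:C.
  by rewrite sqrtCK mulrC divfK // -rmorphXn fmorph_eq0 gt_eqF ?exprn_gt0.
exact: (common_tangents_card a_gt0 hs hp ht).
Qed.

Lemma real_region_tangents_real (R : realType) (m : nat) (a r : R) L :
  0 < a -> real_region (3 + m.+1) a r ->
  common_tangents (3 + m.+1) a r L -> is_real_line L.
Proof.
move=> a_gt0; have gE := gamma_eq m a_gt0; rewrite /real_region.
move: gE; set g := gamma _ a => gE [a2 g3 /andP[gr rg]].
have a20 : 0 < a ^+ 2 by rewrite exprn_gt0.
have m1 : m.+1%:R = m%:R + 1 :> R by rewrite -natr1.
have [alpha [beta [hs hp]]] : exists alpha beta : R,
    alpha ^+ 2 + beta ^+ 2 = 3 - g /\ (alpha * beta) ^+ 2 = r ^+ 2 - g.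
  by apply: two_squares_real; lra.
(* a^2 - g is a^2 (a^2 - 2) / (a^2 + m + 1) *)
have D0 : 0 <= (a ^+ 2 - g) / a ^+ 2.
  rewrite divr_ge0 ?(ltW a20) // subr_ge0.
  have d0 : 0 < a ^+ 2 + m.+1%:R by rewrite addr_gt0.
  by rewrite -(ler_pM2r d0) gE ler_pM2l //; lra.
pose delta := Num.sqrt ((a ^+ 2 - g) / a ^+ 2).
have ht : a ^+ 2 * delta ^+ 2 = a ^+ 2 - g.
  by rewrite sqr_sqrtr // mulrC divfK // gt_eqF.
have c3 : 3%:C = 3 :> R[i] by exact: rmorph_nat.
have hsC : alpha%:C ^+ 2 + beta%:C ^+ 2 = 3 - g%:C.
  by rewrite -c3 -rmorphB -hs rmorphD !rmorphXn.
have hpC : (alpha%:C * beta%:C) ^+ 2 = (r ^+ 2)%:C - g%:C.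
  by rewrite -rmorphB -hp -rmorphM -rmorphXn.
have htC : a%:C ^+ 2 * delta%:C ^+ 2 = a%:C ^+ 2 - g%:C.
  by rewrite -!rmorphXn -rmorphM -rmorphB ht.
move=> /(tangentP a_gt0 hsC hpC htC)[x ->].
apply: tangent_real.
by have [/unit_neq0] := tangent_normalised a_gt0 hsC hpC htC x.
Qed.

(** At a^2 = 3 one has gamma = 3 (n - 1) / n < 3, which leaves an open interval
    for r^2. *)
Lemma real_region_nonempty (R : realType) (m : nat) :
  exists a r : R, [/\ 0 < a, 0 < r & real_region (3 + m.+1) a r].
Proof.
have m0 : 0 <= m%:R :> R by rewrite ler0n.
have m1 : m.+1%:R = m%:R + 1 :> R by rewrite -natr1.
pose a : R := Num.sqrt 3.
have a2 : a ^+ 2 = 3 by rewrite sqr_sqrtr.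
have a_gt0 : 0 < a by rewrite sqrtr_gt0.
have := gamma_eq m a_gt0; set g := gamma _ a; rewrite a2 => gE.
have g0 : 0 < g by nra.
have g3 : g < 3 by nra.
pose t := g + (3 - g) ^+ 2 / 8.
have s0 : 0 < (3 - g) ^+ 2 by rewrite exprn_gt0 // subr_gt0.
have t0 : 0 < t by rewrite /t; lra.
exists a, (Num.sqrt t); split=> //; first by rewrite sqrtr_gt0.
rewrite /real_region a2 sqr_sqrtr ?(ltW t0) // -/g; split=> //; first lra.
by rewrite /t; lra.
Qed.

Theorem theorem5 (R : realType) (n : nat) (hn : (4 <= n)%N) :
  (forall a r : R, 0 < a -> 0 < r ->
     ((r ^+ 2 - 3) * (3 - gamma n a) * (a ^+ 2 - 2) * (r ^+ 2 - gamma n a)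
        * ((3 - gamma n a) ^+ 2 + 4 * gamma n a - 4 * r ^+ 2) != 0 ->
      common_tangents n a r #= `I_(3 * 2 ^ n.-1)%N)
     /\
     (real_region n a r ->
      common_tangents n a r #= `I_(3 * 2 ^ n.-1)%N
      /\ forall L, common_tangents n a r L -> is_real_line L))
  /\
  (exists a r : R, [/\ 0 < a, 0 < r & real_region n a r]).
Proof.
have {hn} [m ->] : exists m, n = (3 + m.+1)%N.
  by exists (n - 4)%N; rewrite addnS -addSn subnKC.
have -> : (3 + m.+1).-1 = (3 + m)%N by rewrite addnS.
split=> [a r a_gt0 _|]; last exact: real_region_nonempty.
split=> [|region].
  rewrite !mulf_eq0 !negb_or => /andP[/andP[/andP[_ a2] rg] disc].
  rewrite subr_eq0 in a2; rewrite subr_eq0 in rg.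
  exact: generic_common_tangents_card.
split=> [|L]; last exact: real_region_tangents_real.
case: region => a2 g3 /andP[gr rg].
by apply: generic_common_tangents_card => //; rewrite gt_eqF //; lra.
Qed.
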